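(* Let $\mathbf{p}=(p_i)_{i\ge1}$ with $p_1=0$, $p_2=1$, $p_i\in(0,1)$ for $i\ge 3$, and assume $\sum_{j=1}^\infty p_j=\infty$. Let $\mu_n$ be the law of $(X_1^{n,\mathbf{p}},\dots,X_n^{n,\mathbf{p}})$, let $\mu$ be the law of $X^{\infty,\mathbf{p}}$, and let $\mu\pi_n^{-1}$ be the image of $\mu$ under the projection $\pi_n(x)=(x_1,\dots,x_n)$. For any $n\in\mathbb{N}$, $$d_{TV}(\mu\pi^{-1}_n,\mu_n)=\varphi_n\,\mathbf{1}\{n>1\}.$$
   Context: Random derangement process: put $q_i=1-p_i$. For $n\ge 1$, $X^{n,\mathbf{p}}=(X^n_{n+1}=1,X^n_n,\dots,X^n_1)$ is the $\{0,1\}$-valued inhomogeneous Markov chain, run in decreasing index and started from $X^n_{n+1}=1$, such that $X^n_1=1$ a.s., $X^n_n=0$ a.s. (for $n\ge2$), and for $2\le r\le n-1$: $\mathbb{P}(X^n_r=0\mid X^n_{r+1}=0)=p_r$, $\mathbb{P}(X^n_r=1\mid X^n_{r+1}=0)=q_r$, $\mathbb{P}(X^n_r=0\mid X^n_{r+1}=1)=1$. Under $\sum_jp_j=\infty$ the limits $\varphi_i=\varphi_i(\mathbf{p})=\lim_{n\to\infty}\mathbb{P}(X^n_i=1)$ exist, with $\varphi_1=1$, $\varphi_2=0$ and $\varphi_i\in(0,1)$ for $i\ge3$. The infinite chain $X^{\infty,\mathbf{p}}=(X_i^\infty)_{i\ge1}$ is the $\{0,1\}$-valued Markov chain, run in increasing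 index, with $X_1^\infty=1$, $\mathbb{P}(X^\infty_{i+1}=1\mid X^\infty_i=0)=1-\mathbb{P}(X^\infty_{i+1}=0\mid X^\infty_i=0)=\frac{\varphi_{i+1}}{1-\varphi_i}$ and $\mathbb{P}(X^\infty_{i+1}=1\mid X^\infty_i=1)=1-\mathbb{P}(X^\infty_{i+1}=0\mid X^\infty_i=1)=0$. $d_{TV}$ is total variation distance, equal to half the $\ell^1$ distance for laws on a finite set. *)

(* Defs.v *)
From HB Require Import structures.
From mathcomp Require Import all_boot all_order all_algebra.
From mathcomp Require Import all_classical all_reals all_analysis.

Set Implicit Arguments.
Unset Strict Implicit.
Unset Printing Implicit Defensive.

Import Order.TTheory GRing.Theory Num.Theory.
Import numFieldNormedType.Exports.

Local Open Scope classical_set_scope.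
Local Open Scope ring_scope.

(* The states 0 and 1 are [false] and [true]. *)

Section Markov.
Context (R : realType) (d : measure_display) (T : measurableType d).
Variable P : probability T R.

(* As 0^-1 = 0, this is 0 when [P B = 0]; every use below assumes
   [P B != 0]. *)
Definition cond_prob (A B : set T) : R := fine (P (A `&` B)) / fine (P B).

Definition history (Y : nat -> T -> bool) (x : nat -> bool) (k : nat) : set T :=
  [set w | forall j, (j <= k)%N -> Y j w = x j].

(* Given Y_0, ..., Y_k, the law of Y_{k+1} depends on Y_k only. *)
Definition markov_step (Y : nat -> T -> bool) (k : nat) : Prop :=
  forall x : nat -> bool, P (history Y x k) != 0%E ->
    cond_prob (Y k.+1 @^-1` [set x k.+1]) (history Y x k) =
    cond_prob (Y k.+1 @^-1` [set x k.+1]) (Y k @^-1` [set x k]).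

(* [X] is the process X_{n+1}, X_n, ..., X_1 with parameters [p]; only the
   indices 1, ..., n+1 are constrained. It is run in decreasing index, so that
   the state at time j is X_{n+1-j}, for 0 <= j <= n. *)
Record derangement_chain (p : nat -> R) (n : nat)
    (X : nat -> {mfun T >-> bool}) : Prop := DerangementChain {
  dc_start : {ae P, forall w, X n.+1 w = true};
  dc_markov : forall k, (k < n)%N ->
    markov_step (fun j => X (n.+1 - j)%N) k;
  dc_one : {ae P, forall w, X 1%N w = true};
  dc_top : (2 <= n)%N -> {ae P, forall w, X n w = false};
  dc_trans00 : forall r, (2 <= r <= n.-1)%N ->
    P (X r.+1 @^-1` [set false]) != 0%E ->
    cond_prob (X r @^-1` [set false]) (X r.+1 @^-1` [set false]) = p r;
  dc_trans01 : forall r, (2 <= r <= n.-1)%N ->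
    P (X r.+1 @^-1` [set false]) != 0%E ->
    cond_prob (X r @^-1` [set true]) (X r.+1 @^-1` [set false]) = 1 - p r;
  dc_trans10 : forall r, (2 <= r <= n.-1)%N ->
    P (X r.+1 @^-1` [set true]) != 0%E ->
    cond_prob (X r @^-1` [set false]) (X r.+1 @^-1` [set true]) = 1 }.

(* [X] is the process X_1, X_2, ... run in increasing index; [X 0] is not
   constrained. *)
Record infinite_derangement_chain (phi : nat -> R)
    (X : nat -> {mfun T >-> bool}) : Prop := InfiniteDerangementChain {
  idc_start : {ae P, forall w, X 1%N w = true};
  idc_markov : forall k, markov_step (fun j => X j.+1) k;
  idc_trans01 : forall i, (1 <= i)%N ->
    P (X i @^-1` [set false]) != 0%E ->
    cond_prob (X i.+1 @^-1` [set true]) (X i @^-1` [set false]) =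
      phi i.+1 / (1 - phi i);
  idc_trans00 : forall i, (1 <= i)%N ->
    P (X i @^-1` [set false]) != 0%E ->
    cond_prob (X i.+1 @^-1` [set false]) (X i @^-1` [set false]) =
      1 - phi i.+1 / (1 - phi i);
  idc_trans11 : forall i, (1 <= i)%N ->
    P (X i @^-1` [set true]) != 0%E ->
    cond_prob (X i.+1 @^-1` [set true]) (X i @^-1` [set true]) = 0;
  idc_trans10 : forall i, (1 <= i)%N ->
    P (X i @^-1` [set true]) != 0%E ->
    cond_prob (X i.+1 @^-1` [set false]) (X i @^-1` [set true]) = 1 }.

End Markov.

(* phi_i = lim_n P(X^n_i = 1); the n-th chain lives on its own space [T n]. *)
Definition phi_lim (R : realType) (d : nat -> measure_display)
    (T : forall n, measurableType (d n)) (P : forall n, probability (T n) R)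
    (X : forall n, nat -> {mfun T n >-> bool}) (i : nat) : R :=
  limn (fun n => fine (P n (X n i @^-1` [set true]))).

(* The product sigma-algebra on {0,1}^{1,2,...}. Coordinates are shifted: the
   k-th entry of a sequence is x_{k+1}. *)
Definition coordinate_sets : set (set (nat -> bool)) :=
  [set A | exists k (B : set bool), A = [set x | B (x k)]].

Definition bool_seq := g_sigma_algebraType coordinate_sets.

Section Paths.
Context (d : measure_display) (T : measurableType d).

Definition fin_path (n : nat) (X : nat -> {mfun T >-> bool}) (w : T) :
    n.-tuple bool :=
  [tuple X i.+1 w | i < n].

Lemma measurable_fin_path n X : measurable_fun [set: T] (@fin_path n X).
Proof.
apply/measurable_fun_tnthP => i.
rewrite (_ : _ \o _ = X i.+1); first exact: measurable_funPT.
by apply/funext => w /=; rewrite tnth_mktuple.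
Qed.

HB.instance Definition _ n X :=
  isMeasurableFun.Build _ _ _ _ (@fin_path n X) (@measurable_fin_path n X).

Definition inf_path (X : nat -> {mfun T >-> bool}) (w : T) : bool_seq :=
  fun k => X k.+1 w.

Lemma measurable_inf_path X : measurable_fun [set: T] (inf_path X).
Proof.
apply: (@measurability _ _ T bool_seq setT (inf_path X) coordinate_sets) => // _ [_ [k [B ->]] <-].
exact: (@measurable_funPT _ _ _ _ (X k.+1) measurableT B).
Qed.

HB.instance Definition _ X :=
  isMeasurableFun.Build _ _ _ _ (inf_path X) (@measurable_inf_path X).

End Paths.

Definition seq_proj (n : nat) (x : bool_seq) : n.-tuple bool :=
  [tuple x i | i < n].

Lemma measurable_seq_proj n : measurable_fun [set: bool_seq] (@seq_proj n).
Proof.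
apply/measurable_fun_tnthP => i _ B mB; rewrite setTI.
apply: sub_sigma_algebra; exists (i : nat), B.
by apply/seteqP; split => x /=; rewrite tnth_mktuple.
Qed.

HB.instance Definition _ n :=
  isMeasurableFun.Build _ _ _ _ (@seq_proj n) (@measurable_seq_proj n).

Definition tv_dist (R : realType) (d : measure_display) (T : measurableType d)
    (mu nu : probability T R) : \bar R :=
  ereal_sup [set `|mu A - nu A|%E | A in (measurable : set (set T))].

(* Main.v *)
(* Since phi_i = (1 - p_i) (1 - phi_(i+1)) for i >= 2, the forward kernel of X^oo
   is the time reversal, with respect to the marginals P(X^oo_i = 1) = phi_i, of
   the backward kernel of X^n. Hence X^oo_n, ..., X^oo_1 runs backwards with the
   same kernel as X^n, but from X^oo_n ~ Bernoulli(phi_n) instead of X^n_n = 0: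
   restricted to {x_n = 0}, the law of (X^oo_1, ..., X^oo_n) is (1 - phi_n) mu_n,
   and mu_n does not charge {x_n = 1}, which has mass phi_n for X^oo. *)
Require Import Defs.
From mathcomp Require Import all_boot all_order all_algebra.
From mathcomp Require Import all_classical all_reals all_analysis.
From mathcomp Require Import ring lra zify.

Set Implicit Arguments.
Unset Strict Implicit.
Unset Printing Implicit Defensive.

Import Order.TTheory GRing.Theory Num.Theory.
Import numFieldNormedType.Exports.

Local Open Scope classical_set_scope.
Local Open Scope ring_scope.

(** * Boolean events, conditioning and path probabilities *)

Lemma measurable_preimage_bool (d : measure_display) (T : measurableType d)
    (f : {mfun T >-> bool}) (b : bool) :
  measurable (f @^-1` [set b]).
Proof. by rewrite -[X in measurable X]setTI; exact: measurable_funPT. Qed.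

#[local] Hint Extern 0 (measurable (_ @^-1` [set _])) =>
  apply: measurable_preimage_bool : core.

Section BoolProcess.
Context (R : realType) (d : measure_display) (T : measurableType d).
Variable P : probability T R.
Implicit Types (A B : set T) (Y : nat -> T -> bool).

Lemma preimage_falseE (f : T -> bool) :
  f @^-1` [set false] = ~` (f @^-1` [set true]).
Proof. by apply/seteqP; split=> w /=; case: (f w). Qed.

Lemma prob_split A B : measurable A -> measurable B ->
  fine (P A) = fine (P (A `&` B)) + fine (P (A `&` ~` B)).
Proof.
move=> mA mB; rewrite -fineD ?fin_num_measure//; last 2 first.
- exact: measurableI.
- by apply: measurableI => //; exact: measurableC.
by rewrite addeC -setDE -measureDI.
Qed.

Lemma le_prob A B : measurable A -> measurable B -> A `<=` B ->
  fine (P A) <= fine (P B).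
Proof.
by move=> mA mB AB; rewrite fine_le ?fin_num_measure// le_measure// inE.
Qed.

Lemma prob_ge0 A : 0 <= fine (P A).
Proof. exact: fine_ge0. Qed.

Lemma prob_eq0 A : measurable A -> (P A == 0%E) = (fine (P A) == 0).
Proof. by move=> mA; rewrite -{1}(fineK (fin_num_measure P A mA)) eqe. Qed.

Lemma prob_setC A : measurable A -> fine (P (~` A)) = 1 - fine (P A).
Proof. by move=> mA; rewrite probability_setC// fineB ?fin_num_measure. Qed.

Lemma ae_prob1 (f : {mfun T >-> bool}) (b : bool) :
  {ae P, forall w, f w = b} -> fine (P (f @^-1` [set b])) = 1.
Proof.
move=> fb; have mb := measurable_preimage_bool f b.
have /(negligibleP _ (measurableC mb)) : P.-negligible (~` (f @^-1` [set b])).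
  exact: fb.
move=> /(congr1 fine); rewrite prob_setC//= => h.
by apply/esym/eqP; rewrite -subr_eq0 h.
Qed.

Lemma probI1 A B : measurable A -> measurable B -> fine (P A) = 1 ->
  fine (P (A `&` B)) = fine (P B).
Proof.
move=> mA mB A1; rewrite (prob_split mB mA) [B `&` A]setIC.
suff -> : fine (P (B `&` ~` A)) = 0 by rewrite addr0.
apply/eqP; rewrite eq_le prob_ge0 andbT.
apply: (@le_trans _ _ (fine (P (~` A)))).
  apply: le_prob => //; last exact: measurableC.
  by apply: measurableI => //; exact: measurableC.
by rewrite prob_setC// A1 subrr.
Qed.

Lemma cond_prob_setC A B : measurable A -> measurable B -> P B != 0%E ->
  cond_prob P (~` A) B = 1 - cond_prob P A B.
Proof.
move=> mA mB; rewrite prob_eq0// => B0; apply/eqP; rewrite eq_sym subr_eq.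
rewrite /cond_prob -mulrDl ![_ `&` B]setIC addrC -prob_split//.
by rewrite divff.
Qed.

Lemma history_succ Y x k :
  history Y x k.+1 = Y k.+1 @^-1` [set x k.+1] `&` history Y x k.
Proof.
apply/seteqP; split=> [w h|w [h1 h2] j]; first split=> [|j jk].
- exact: h.
- by apply: h; rewrite ltnW.
by rewrite leq_eqVlt => /predU1P[->//|]; exact: h2.
Qed.

Lemma measurable_history Y x k :
  (forall j b, measurable (Y j @^-1` [set b])) -> measurable (history Y x k).
Proof.
move=> mY; elim: k => [|k IH]; last first.
  by rewrite history_succ; apply: measurableI.
rewrite (_ : history _ _ _ = Y 0%N @^-1` [set x 0%N])//.
apply/seteqP; split=> w; first by move=> /(_ 0%N); exact.
by move=> h j; rewrite leqn0 => /eqP ->.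
Qed.

(** One step of the chain rule. The value [t] has to be right only when the current state has
    positive probability: otherwise the history is null and both sides vanish. *)
Lemma prob_history_succ Y x k (t : R) :
  (forall j b, measurable (Y j @^-1` [set b])) -> markov_step P Y k ->
  (P (Y k @^-1` [set x k]) != 0%E ->
    cond_prob P (Y k.+1 @^-1` [set x k.+1]) (Y k @^-1` [set x k]) = t) ->
  fine (P (history Y x k.+1)) = fine (P (history Y x k)) * t.
Proof.
move=> mY mstep ht; have mH := measurable_history x k mY.
rewrite history_succ.
have [H0|H0] := eqVneq (fine (P (history Y x k))) 0.
  rewrite H0 mul0r; apply/eqP; rewrite eq_le prob_ge0 andbT -H0.
  by apply: le_prob => //; apply: measurableI.
rewrite -ht; last first.
  (* The history is contained in the event on the current state, so a null state would force a null
     history. *)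
  rewrite prob_eq0//; apply: contra_neq H0 => h; apply/eqP.
  rewrite eq_le prob_ge0 andbT -h; apply: le_prob => //.
  by move=> w; apply.
by rewrite -mstep ?prob_eq0// /cond_prob mulrCA divff ?mulr1.
Qed.

End BoolProcess.

(** * Total variation distance and laws on finite tuples *)

Lemma tv_dist_eq (R : realType) (d : measure_display) (T : measurableType d)
    (mu nu : probability T R) (E : set T) (c : R) :
  measurable E -> 0 <= c -> nu E = 0%E ->
  (forall A, measurable A -> A `<=` ~` E ->
    fine (mu A) = (1 - c) * fine (nu A)) ->
  tv_dist mu nu = c%:E.
Proof.
move=> mE c0 nuE muE; have mC := measurableC mE.
have muEc : fine (mu E) = c.
  have := muE _ mC (@subset_refl _ _).
  rewrite !prob_setC// nuE subr0 mulr1; lra.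
apply/eqP; rewrite eq_le; apply/andP; split.
  apply: ge_ereal_sup => _ /= [A mA <-].
  rewrite -(fineK (fin_num_measure mu A mA)) -(fineK (fin_num_measure nu A mA)).
  rewrite -EFinB abse_EFin lee_fin.
  have mAE := measurableI _ _ mA mE; have mAC := measurableI _ _ mA mC.
  have nuA0 : fine (nu (A `&` E)) = 0.
    by apply/eqP; rewrite eq_le prob_ge0 andbT -[leRHS]/(fine 0%E) -nuE le_prob.
  rewrite (prob_split mu mA mE) (prob_split nu mA mE) nuA0.
  rewrite (muE (A `&` ~` E))//.
  have h1 := le_prob mu mAE mE (@subIsetr _ A E); rewrite muEc in h1.
  have h2 := prob_ge0 mu (A `&` E).
  have h3 := prob_ge0 nu (A `&` ~` E).
  have h4 : fine (nu (A `&` ~` E)) <= 1.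
    have := le_prob nu mAC measurableT (@subsetT _ _).
    by rewrite probability_setT.
  rewrite ler_norml; apply/andP; split; nra.
apply: ereal_sup_ubound; exists E => //=.
by rewrite nuE sube0 -(fineK (fin_num_measure mu E mE)) muEc abse_EFin ger0_norm.
Qed.

Lemma measurable_tuple_bool n (A : set (n.-tuple bool)) : measurable A.
Proof.
have m1 (x : n.-tuple bool) : measurable [set x].
  rewrite (_ : [set x] =
      \bigcap_(i in [set: 'I_n]) ((@tnth n bool ^~ i) @^-1` [set tnth x i])).
    apply: fin_bigcap_measurable => // i _; rewrite -[X in measurable X]setTI.
    exact: measurable_tnth.
  apply/seteqP; split=> [y -> //|y h].
  by apply/eq_from_tnth => i; apply: (h i).
have -> : A = \bigcup_(x in A) [set x] by rewrite bigcup_imset1 image_id.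
by apply: fin_bigcup_measurable => // x _; exact: m1.
Qed.

(** Both measures are finite sums of point masses, so a comparison of path probabilities passes to
    events. *)
Lemma eq_prob_tuple_bool (R : realType) n (mu nu : probability (n.-tuple bool) R)
    (c : R) (A : set (n.-tuple bool)) :
  (forall x, A x -> fine (mu [set x]) = c * fine (nu [set x])) ->
  fine (mu A) = c * fine (nu A).
Proof.
move=> h.
have sumE (rho : probability (n.-tuple bool) R) :
    rho A = (\sum_(x \in A) (fine (rho [set x]))%:E)%E.
  rewrite -[in LHS](image_id A) -bigcup_imset1 measure_fin_bigcup; last 3 first.
  - exact: finite_finset.
  - by move=> i j _ _ [x [-> ->]].
  - by move=> x _; exact: measurable_tuple_bool.
  apply: eq_fsbigr => x _; rewrite fineK// fin_num_measure//.
  exact: measurable_tuple_bool.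
have fA : finite_set A := finite_finset.
rewrite !sumE !fsbig_finite//= !sumEFin /= mulr_sumr.
rewrite big_seq [RHS]big_seq; apply: eq_bigr => x.
by rewrite in_fset_set// inE => /h.
Qed.

(** * Convergence of the marginals of the finite chains *)

Lemma nneseries_pinfty_gt (R : realType) (u : nat -> R) m :
  (forall j, (m <= j)%N -> 0 <= u j) ->
  (\sum_(m <= j <oo) (u j)%:E)%E = +oo%E ->
  forall M : R, exists N, M < \sum_(m <= j < N) u j.
Proof.
move=> u0 uoo M; apply: contrapT => h.
suff : (+oo <= M%:E)%E by [].
rewrite -uoo; apply: lime_le.
  by apply: is_cvg_nneseries => n mn _; rewrite lee_fin u0.
apply: nearW => N; rewrite sumEFin lee_fin leNgt; apply/negP => MN.
by apply: h; exists N.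
Qed.

Section AlternatingRecursion.
Context (R : realType) (p : nat -> R) (a : nat -> nat -> R).
Hypothesis p01 : forall j, (1 <= j)%N -> 0 <= p j <= 1.
Hypothesis p_div : (\sum_(1 <= j <oo) (p j)%:E)%E = +oo%E.
Hypothesis a01 : forall n i, 0 <= a n i <= 1.
Hypothesis a_rec : forall n r, (2 <= r < n)%N ->
  a n r = (1 - p r) * (1 - a n r.+1).

(* Elementary form of [1 - p <= exp (- p)]. *)
Lemma prod_onem_le i k : (1 <= i)%N ->
  0 <= \prod_(i <= j < i + k) (1 - p j) /\
  (\prod_(i <= j < i + k) (1 - p j)) * (1 + \sum_(i <= j < i + k) p j) <= 1.
Proof.
move=> i1; elim: k => [|k [IH0 IH1]].
  by rewrite addn0 !big_geq//; split; lra.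
rewrite addnS !big_nat_recr ?leq_addr//=.
have := @p01 (i + k) (leq_trans i1 (leq_addr _ _)).
have S0 : 0 <= \sum_(i <= j < i + k) p j.
  rewrite big_nat; apply: sumr_ge0 => j /andP[ij _].
  by have /andP[] := p01 (leq_trans i1 ij).
set q := \prod_(i <= j < i + k) _ in IH0 IH1 *.
set S := \sum_(i <= j < i + k) _ in IH1 S0 *.
set x := p (i + k)%N => /andP[x0 x1]; split; first nra.
have : 0 <= q * (x * (S + x)) by rewrite !mulr_ge0// addr_ge0.
lra.
Qed.

(** The constant term of [a_rec] cancels in a difference, so going from index [r.+1] to [r]
    contracts the distance by [1 - p r]; at index [i + k] the distance is at most 1. *)
Lemma dist_rec_le i k n m : (2 <= i)%N -> (i + k <= n)%N -> (i + k <= m)%N ->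
  `|a m i - a n i| <= \prod_(i <= j < i + k) (1 - p j).
Proof.
elim: k i => [|k IH] i i2 ikn ikm.
  rewrite addn0 big_geq// ler_norml.
  have := a01 n i; have := a01 m i; lra.
have im : (2 <= i < m)%N by lia.
have in_ : (2 <= i < n)%N by lia.
rewrite (a_rec im) (a_rec in_).
rewrite -mulrBr opprD addrACA subrr add0r opprK normrM.
have /andP[_ p1] := p01 (ltnW i2).
rewrite ger0_norm ?subr_ge0// big_ltn; last lia.
rewrite ler_wpM2l ?subr_ge0// addrC distrC -addSnnS.
apply: IH; lia.
Qed.

(** The divergence of the sum of the [p j] drives the contraction factor to 0, which makes the
    sequence Cauchy. *)
Lemma is_cvg_rec i : (2 <= i)%N -> cvgn (a ^~ i).
Proof.
move=> i2; apply: cauchy_cvg; apply: cauchy_exP => e e0.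
have pge0 j : (1 <= j)%N -> 0 <= p j by move=> /p01/andP[].
(* The sum over [j < i] is included in the bound so that the tail from [i] to [N] alone exceeds
   [e^-1]. *)
have [N hN] := nneseries_pinfty_gt pge0 p_div (e^-1 + \sum_(1 <= j < i) p j).
have iN : (i <= N)%N.
  rewrite leqNgt; apply/negP => Ni; move: hN; apply/negP; rewrite -leNgt.
  have [N1|N1] := leqP N 1; first rewrite [leLHS]big_geq//.
    apply: addr_ge0; first by rewrite invr_ge0 ltW.
    by rewrite big_nat; apply: sumr_ge0 => j /andP[/pge0].
  rewrite [\sum_(1 <= j < i) _](@big_cat_nat _ _ _ N)/=; [|lia|lia].
  rewrite addrCA lerDl; apply: addr_ge0; first by rewrite invr_ge0 ltW.
  rewrite big_nat; apply: sumr_ge0 => j /andP[Nj _]; apply: pge0; lia.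
move: hN; rewrite [\sum_(1 <= j < N) _](@big_cat_nat _ _ _ i)//=; last lia.
rewrite [ltRHS]addrC ltrD2r => hN.
exists (a N i); exists N => // m /= Nm.
rewrite /ball/= (le_lt_trans (@dist_rec_le i (N - i) m N _ _ _))//; try lia.
have := @prod_onem_le i (N - i) (ltnW i2); rewrite subnKC// => -[q0].
set q := \prod_(i <= j < N) _ in q0 *; set S := \sum_(i <= j < N) _ in hN *.
(* If [e <= q], then [e + 1 = e * (1 + e^-1) < e * (1 + S) <= q * (1 + S) <= 1], which is absurd. *)
move=> qS; rewrite ltNge; apply/negP => eq.
have : e * (1 + e^-1) < 1.
  apply: lt_le_trans qS.
  apply: (@lt_le_trans _ _ (e * (1 + S))); first by rewrite ltr_pM2l// ltrD2l.
  by rewrite ler_wpM2r//; have := invr_gt0 e; rewrite e0; lra.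
by rewrite mulrDr divff ?gt_eqF// mulr1; lra.
Qed.

End AlternatingRecursion.

(* The kernel of X^n, from state [a] at index [r.+1] to state [b] at index [r];
   [r = 1] is apart because X^n_1 = 1 whatever X^n_2 is. *)
Definition back_step (R : realType) (p : nat -> R) (r : nat) (a b : bool) : R :=
  if r == 1%N then b%:R
  else if a then (~~ b)%:R else if b then 1 - p r else p r.

(* The kernel of X^oo, from state [a] at index [i] to state [b] at [i.+1]. *)
Definition fwd_step (R : realType) (phi : nat -> R) (i : nat) (a b : bool) : R :=
  if a then (~~ b)%:R
  else if b then phi i.+1 / (1 - phi i) else 1 - phi i.+1 / (1 - phi i).

Definition bernoulli_mass (R : realType) (c : R) (b : bool) : R :=
  if b then c else 1 - c.

(** * Marginals and path probabilities of the finite chain *)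

Section FiniteChain.
Context (R : realType) (d : measure_display) (T : measurableType d).
Variables (P : probability T R) (p : nat -> R) (n : nat).
Variable X : nat -> {mfun T >-> bool}.
Hypothesis X_chain : derangement_chain P p n X.

(** At [r = 1] the value comes from X_1 = 1 almost surely; for larger [r] from the transition
    clauses, the transition from 1 to 1 being found by complement. *)
Lemma finite_chain_cond r a b : (1 <= r < n)%N ->
  P (X r.+1 @^-1` [set a]) != 0%E ->
  cond_prob P (X r @^-1` [set b]) (X r.+1 @^-1` [set a]) = back_step p r a b.
Proof.
move=> /andP[r1 rn] Pa0.
have condF c : cond_prob P (X r @^-1` [set true]) (X r.+1 @^-1` [set a]) = c ->
    cond_prob P (X r @^-1` [set false]) (X r.+1 @^-1` [set a]) = 1 - c.
  by rewrite (preimage_falseE (X r)) => <-; rewrite cond_prob_setC.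
rewrite /back_step; case: eqVneq => [r1E|rN1].
  suff h : cond_prob P (X r @^-1` [set true]) (X r.+1 @^-1` [set a]) = 1.
    by case: b; [rewrite h|rewrite (condF _ h) subrr].
  rewrite /cond_prob probI1//; last first.
    by apply: ae_prob1; rewrite r1E; exact: dc_one X_chain.
  by rewrite divff// -prob_eq0.
have r2n : (2 <= r <= n.-1)%N by lia.
case: a Pa0 condF => Pa0 condF.
  have h := dc_trans10 X_chain r2n Pa0.
  by case: b => //=; have := condF _ erefl; rewrite h; lra.
by case: b; [exact: (dc_trans01 X_chain)|exact: (dc_trans00 X_chain)].
Qed.

(** State 1 at index [r] can be entered only from state 0 at [r.+1], which happens with probability
    [1 - p r]. *)
Lemma finite_chain_rec r : (2 <= r < n)%N ->
  fine (P (X r @^-1` [set true])) =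
  (1 - p r) * (1 - fine (P (X r.+1 @^-1` [set true]))).
Proof.
move=> /andP[r2 rn].
have r1n : (1 <= r < n)%N by lia.
have joint a : fine (P (X r @^-1` [set true] `&` X r.+1 @^-1` [set a])) =
    back_step p r a true * fine (P (X r.+1 @^-1` [set a])).
  have [h|h] := eqVneq (fine (P (X r.+1 @^-1` [set a]))) 0.
    rewrite h mulr0; apply/eqP; rewrite eq_le prob_ge0 andbT -h le_prob//.
    exact: measurableI.
  by rewrite -finite_chain_cond ?prob_eq0// /cond_prob -mulrA mulVf ?mulr1.
rewrite (prob_split P (measurable_preimage_bool (X r) _)
  (measurable_preimage_bool (X r.+1) true)).
rewrite -preimage_falseE !joint preimage_falseE prob_setC//.
by rewrite /back_step; case: eqVneq => [|_] /=; [lia|rewrite mul0r add0r].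
Qed.

Hypothesis n2 : (2 <= n)%N.

(** Here [x j] is the value of X_(j+1), and time [j] is index [n.+1 - j]; hence the value [true] at
    time 0 and [x (n - j)] at later times. The first factor is the forced X_n = 0. *)
Lemma finite_chain_history (x : nat -> bool) k : (k < n)%N ->
  fine (P (history (fun j => X (n.+1 - j)%N)
    (fun j => if j is 0 then true else x (n - j)%N) k.+1)) =
  (~~ x n.-1)%:R *
  \prod_(n.-1 - k <= j < n.-1) back_step p j.+1 (x j.+1) (x j).
Proof.
have mY j b : measurable
  ((fun j => X (n.+1 - j)%N : T -> bool) j @^-1` [set b]) by [].
elim: k => [_|k IH kn].
  (* Times 0 and 1 are both deterministic: X_(n+1) = 1 drops out, and X_n = 0 leaves the
     indicator. *)
  rewrite subn0 big_geq// mulr1 history_succ /= subn1 /= subn1 setIC.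
  rewrite probI1//; last 2 first.
  - exact: (measurable_history _ _ mY).
  - rewrite (_ : history _ _ _ = X n.+1 @^-1` [set true]).
      by apply: ae_prob1; exact: dc_start X_chain.
    apply/seteqP; split=> w; first by move=> /(_ 0%N (leqnn _)); rewrite subn0.
    by move=> h j; rewrite leqn0 => /eqP ->; rewrite subn0.
  have h0 := ae_prob1 (dc_top X_chain n2).
  case: (x n.-1) => //=.
  rewrite -[X in fine (P X)]setCK -preimage_falseE prob_setC// h0.
  by rewrite subrr.
rewrite (@prob_history_succ _ _ _ P _ _ _
  (back_step p (n.-1 - k.+1).+1 (x (n.-1 - k.+1).+1) (x (n.-1 - k.+1)%N))
  mY); last 2 first.
- exact: dc_markov X_chain _ kn.
(* Every index is expressed through [n.-1 - k.+1], the position in [x] of the newly revealed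
   entry. *)
- have -> : (n.+1 - k.+2 = (n.-1 - k.+1).+1)%N by lia.
  have -> : (n.+1 - k.+1 = (n.-1 - k.+1).+2)%N by lia.
  have -> : (n - k.+2 = n.-1 - k.+1)%N by lia.
  have -> : (n - k.+1 = (n.-1 - k.+1).+1)%N by lia.
  by apply: finite_chain_cond; lia.
rewrite IH; last lia.
rewrite [in RHS]big_ltn; last lia.
have -> : (n.-1 - k = (n.-1 - k.+1).+1)%N by lia.
by rewrite -mulrA [X in _ * X]mulrC.
Qed.

Lemma finite_chain_path (x : n.-tuple bool) :
  fine (distribution P (fin_path n X) [set x]) =
  (~~ nth false x n.-1)%:R *
  \prod_(0 <= j < n.-1)
    back_step p j.+1 (nth false x j.+1) (nth false x j).
Proof.
have mY j b : measurable
  ((fun j => X (n.+1 - j)%N : T -> bool) j @^-1` [set b]) by [].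
have := @finite_chain_history (nth false x) n.-1.
rewrite subnn prednK; last lia.
move=> <-//; rewrite /distribution /pushforward.
(* The history also records X_(n+1), which the tuple omits; this almost sure event is inserted to
   match. *)
rewrite -[LHS](probI1 (A := X n.+1 @^-1` [set true])) //; first last.
- by apply: ae_prob1; exact: dc_start X_chain.
- rewrite -[X in measurable X]setTI; apply: measurable_fin_path => //.
  exact: measurable_tuple_bool.
congr (fine (P _)); apply/seteqP; split=> w.
  move=> [w0 /= wx] [|j] jn; first by rewrite subn0.
  rewrite -wx subSS; have jn' : (n - j.+1 < n)%N by lia.
  rewrite -[(n - j.+1)%N]/(nat_of_ord (Ordinal jn')) -tnth_nth tnth_mktuple /=.
  by congr (X _ w); lia.
move=> h; split; first by have /= := h 0%N isT; rewrite subn0.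
apply: eq_from_tnth => i; rewrite tnth_mktuple (tnth_nth false).
have := h (n - i)%N (leq_subr _ _).
have -> : (n.+1 - (n - i) = i.+1)%N by have := ltn_ord i; lia.
move=> ->; case E : (n - i)%N => [|m]; first by have := ltn_ord i; lia.
by congr nth; have := ltn_ord i; lia.
Qed.

End FiniteChain.

(** * Path probabilities of the infinite chain *)

Section InfiniteChain.
Context (R : realType) (d : measure_display) (T : measurableType d).
Variables (P : probability T R) (p phi : nat -> R).
Variable X : nat -> {mfun T >-> bool}.
Hypothesis X_chain : infinite_derangement_chain P phi X.
Hypothesis phi1 : phi 1%N = 1.
Hypothesis phi2 : phi 2%N = 0.
Hypothesis phi_rec : forall i, (2 <= i)%N -> phi i = (1 - p i) * (1 - phi i.+1).
Hypothesis phi_neq1 : forall i, (2 <= i)%N -> phi i != 1.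

Lemma infinite_chain_cond i a b : (1 <= i)%N ->
  P (X i @^-1` [set a]) != 0%E ->
  cond_prob P (X i.+1 @^-1` [set b]) (X i @^-1` [set a]) = fwd_step phi i a b.
Proof.
move=> i1; case: a => Pa0; case: b.
- exact: (idc_trans11 X_chain).
- exact: (idc_trans10 X_chain).
- exact: (idc_trans01 X_chain).
- exact: (idc_trans00 X_chain).
Qed.

(* Detailed balance: the two kernels are reversals of each other with respect to
   the marginals [phi]. *)
Lemma fwd_step_balance i a b : (1 <= i)%N ->
  bernoulli_mass (phi i) a * fwd_step phi i a b =
  bernoulli_mass (phi i.+1) b * back_step p i b a.
Proof.
move=> i1; rewrite /back_step; case: eqVneq => [->|iN1].
  (* With [phi 1 = 1] and [phi 2 = 0], both sides are nonzero only for [a = true] and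
     [b = false]. *)
  by rewrite /fwd_step phi1 phi2; case: a; case: b => /=; lra.
have i2 : (2 <= i)%N by lia.
have phiN1 : 1 - phi i != 0 by rewrite subr_eq0 eq_sym phi_neq1.
have := phi_rec i2; rewrite /fwd_step.
case: a; case: b => /=; [lra|lra|move=> _; field => //|].
have -> : (1 - phi i) * (1 - phi i.+1 / (1 - phi i)) = 1 - phi i - phi i.+1.
  by field.
lra.
Qed.

(** By induction with [fwd_step_balance]: each forward factor turns into a backward one, and the
    marginal mass moves on to the newest entry. *)
Lemma infinite_chain_history (x : nat -> bool) k :
  fine (P (history (fun j => X j.+1) x k)) =
  bernoulli_mass (phi k.+1) (x k) *
  \prod_(0 <= j < k) back_step p j.+1 (x j.+1) (x j).
Proof.
have mY j b : measurable
  ((fun j => X j.+1 : T -> bool) j @^-1` [set b]) by [].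
elim: k => [|k IH].
  rewrite big_geq// mulr1 phi1.
  rewrite (_ : history _ _ _ = X 1%N @^-1` [set x 0%N]); last first.
    apply/seteqP; split=> w; first by move=> /(_ 0%N (leqnn _)).
    by move=> h j; rewrite leqn0 => /eqP ->.
  have h1 := ae_prob1 (idc_start X_chain).
  by case: (x 0%N) => //=; rewrite preimage_falseE prob_setC// h1.
rewrite (prob_history_succ mY (@idc_markov _ _ _ _ _ _ X_chain k)
  (@infinite_chain_cond k.+1 _ _ isT)) IH.
by rewrite mulrAC fwd_step_balance// big_nat_recr//= mulrAC mulrA.
Qed.

(** The product is the one of [finite_chain_path]; only the factor for the last entry differs. *)
Lemma infinite_chain_path n (x : n.-tuple bool) : (1 <= n)%N ->
  fine (distribution (distribution P (inf_path X)) (@seq_proj n) [set x]) =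
  bernoulli_mass (phi n) (nth false x n.-1) *
  \prod_(0 <= j < n.-1)
    back_step p j.+1 (nth false x j.+1) (nth false x j).
Proof.
move=> n1; have := infinite_chain_history (nth false x) n.-1.
rewrite prednK// => <-; rewrite /distribution /pushforward.
congr (fine (P _)); apply/seteqP; split=> w.
  move=> /= <- j jn; have jn' : (j < n)%N by lia.
  by rewrite -[j in RHS]/(nat_of_ord (Ordinal jn')) -tnth_nth tnth_mktuple.
move=> h; apply: eq_from_tnth => i; rewrite tnth_mktuple (tnth_nth false).
by apply: h; have := ltn_ord i; lia.
Qed.

End InfiniteChain.

(** * Properties of the limits phi_i *)

Section Limits.
Context (R : realType) (p : nat -> R) (d : nat -> measure_display)
  (T : forall n, measurableType (d n)) (P : forall n, probability (T n) R)
  (X : forall n, nat -> {mfun T n >-> bool}).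
Hypothesis X_chain : forall n, (1 <= n)%N -> derangement_chain (P n) p n (X n).

Lemma phi_lim1 : phi_lim P X 1 = 1.
Proof.
apply: lim_near_cst => //; exists 1%N => // n /= n1.
by apply: ae_prob1; exact: dc_one (X_chain n1).
Qed.

Hypothesis p01 : forall j, (1 <= j)%N -> 0 <= p j <= 1.
Hypothesis p_div : (\sum_(1 <= j <oo) (p j)%:E)%E = +oo%E.

Let a n i := fine (P n (X n i @^-1` [set true])).

Let a01 n i : 0 <= a n i <= 1.
Proof.
rewrite prob_ge0 /=; apply: le_trans (le_prob (P n) _ _ (@subsetT _ _)) _ => //.
by rewrite probability_setT.
Qed.

Let a_rec n r : (2 <= r < n)%N -> a n r = (1 - p r) * (1 - a n r.+1).
Proof.
move=> rn; have n1 : (1 <= n)%N by lia.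
exact: finite_chain_rec (X_chain n1) _ rn.
Qed.

Let cvg_a i : (2 <= i)%N -> cvgn (a ^~ i).
Proof. exact: (is_cvg_rec p01 p_div a01 a_rec). Qed.

Lemma phi_lim_rec i : (2 <= i)%N ->
  phi_lim P X i = (1 - p i) * (1 - phi_lim P X i.+1).
Proof.
move=> i2; apply: cvg_lim => //.
(* The recursion for the [n]-th chain at index [i] holds only for [i < n], hence the eventual
   equality. *)
apply: (@cvg_trans _ ((fun n => (1 - p i) * (1 - a n i.+1)) @ \oo)).
  apply: near_eq_cvg; exists i.+1 => // n /= ilt.
  by rewrite -a_rec// i2.
apply: cvgMr; apply: cvgB; first exact: cvg_cst.
by apply: cvg_a; lia.
Qed.

Lemma phi_lim_01 i : (2 <= i)%N -> 0 <= phi_lim P X i <= 1.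
Proof.
move=> i2; apply/andP; split.
  by apply: limr_ge; [exact: cvg_a|apply: nearW => n; have /andP[] := a01 n i].
by apply: limr_le; [exact: cvg_a|apply: nearW => n; have /andP[] := a01 n i].
Qed.

End Limits.

(** * Comparison of the two laws *)

Theorem theorem5 (R : realType) (p : nat -> R)
    (p1 : p 1%N = 0) (p2 : p 2%N = 1)
    (p01 : forall i, (3 <= i)%N -> 0 < p i < 1)
    (p_div : (\sum_(1 <= j <oo) (p j)%:E)%E = +oo%E)
    (d : nat -> measure_display) (T : forall n, measurableType (d n))
    (P : forall n, probability (T n) R)
    (X : forall n, nat -> {mfun T n >-> bool})
    (X_chain : forall n, (1 <= n)%N -> derangement_chain (P n) p n (X n))
    (d' : measure_display) (T' : measurableType d') (P' : probability T' R)
    (Xoo : nat -> {mfun T' >-> bool})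
    (Xoo_chain : infinite_derangement_chain P' (phi_lim P X) Xoo)
    (n : nat) (n_ge1 : (1 <= n)%N) :
  let mu_n : probability _ R := distribution (P n) (fin_path n (X n)) in
  let mu : probability _ R := distribution P' (inf_path Xoo) in
  let mu_proj : probability _ R := distribution mu (@seq_proj n) in
  tv_dist mu_proj mu_n = (phi_lim P X n * (1 < n)%N%:R)%:E.
Proof.
have p01' j : (1 <= j)%N -> 0 <= p j <= 1.
  case: j => [|[|[|j]]]// _; [rewrite p1|rewrite p2|]; rewrite ?lexx ?ler01//.
  by have /andP[/ltW -> /ltW ->] := @p01 j.+3 isT.
have phi1 := phi_lim1 X_chain.
have phi_rec := phi_lim_rec X_chain p01' p_div.
have phi01 := phi_lim_01 X_chain p01' p_div.
have phi2 : phi_lim P X 2 = 0 by rewrite phi_rec// p2 subrr mul0r.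
(* For [i >= 3] the recursion gives [phi_i <= 1 - p i < 1]. *)
have phiN1 i : (2 <= i)%N -> phi_lim P X i != 1.
  rewrite leq_eqVlt => /predU1P[<-|i3]; first by rewrite phi2 eq_sym oner_eq0.
  have /andP[p0 _] := p01 _ i3; have := phi_rec i (ltnW i3).
  have /andP[h0 h1] := phi01 i.+1 (ltnW (ltnW i3)).
  by move=> h; apply/negP => /eqP; nra.
have pathoo := infinite_chain_path Xoo_chain phi1 phi2 phi_rec phiN1.
move=> mu_n mu mu_proj.
have [n2|] := ltnP 1 n; last first.
  move=> n_le1; have n1 : n = 1%N by lia.
  (* For [n = 1] both laws are the point mass at 1, so the empty set serves with [c = 0]. *)
  subst n; rewrite mulr0; apply: (@tv_dist_eq _ _ _ _ _ set0) => //.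
  move=> A _ _; apply: eq_prob_tuple_bool => x _.
  rewrite pathoo// subr0 mul1r big_geq// mulr1 phi1.
  have -> : fine (mu_n [set x]) =
      fine (P 1%N (X 1%N 1%N @^-1` [set nth false x 0])).
    congr (fine (P 1%N _)); apply/seteqP; split=> w.
      by move=> /= <-; rewrite -[0%N]/(nat_of_ord (@ord0 0)) -tnth_nth tnth_mktuple.
    move=> h; apply: eq_from_tnth => i; rewrite tnth_mktuple (tnth_nth false).
    by rewrite ord1.
  have h1 := ae_prob1 (dc_one (X_chain 1%N isT)).
  by case: (nth _ _ _) => //=; rewrite preimage_falseE prob_setC ?h1.
have pathn := finite_chain_path (X_chain _ n_ge1) n2.
rewrite mulr1.
have mA := @measurable_tuple_bool n.
(* The extremal event is {x_n = 1}; entries are numbered from 0, so x_n sits at position [n.-1]. *)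
apply: (tv_dist_eq (mA [set x | nth false x n.-1])).
- by have /andP[] := phi01 _ n2.
- apply/eqP; rewrite prob_eq0//; apply/eqP.
  (* Writing 0 as a zero multiple of [mu_n] lets the pointwise comparison be used with [c = 0]. *)
  rewrite -[RHS](mul0r (fine (mu_n [set x | nth false x n.-1]))).
  apply: eq_prob_tuple_bool => x /= xn.
  by rewrite pathn xn mul0r mul0r.
- move=> A _ AE; apply: eq_prob_tuple_bool => x /AE /= xn.
  (* When x_n = 0 the last-entry factors are [1 - phi_n] for the infinite chain and 1 for the finite
     one. *)
  by rewrite pathoo// pathn; case: nth xn => //= _; rewrite mul1r.
Qed.
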